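(* Let $\mathcal{H}$ be a real Hilbert space, let $\mathcal{Y} \subset \mathcal{H}$ be non-empty, open and convex, and let $f : \mathcal{Y} \to \mathcal{H}$ be $C^1$. The following properties are equivalent: (a) $f$ is a proximity operator of a function $\varphi:\mathcal{H} \to \mathbb{R} \cup \{+\infty\}$ (that is, of some such $\varphi$); (b) there exists a convex function $\psi$ that is $C^{2}$ on $\mathcal{Y}$ such that $f(y) = \nabla \psi(y)$ for each $y \in \mathcal{Y}$; (c) the differential $Df(y)$ is a symmetric positive semi-definite operator for each $y \in \mathcal{Y}$.
   Context: For $\varphi: \mathcal{H} \to \mathbb{R}\cup\{+\infty\}$ and $y \in \mathcal{H}$, $\mathrm{prox}_\varphi(y) := \arg\min_{x \in \mathcal{H}} \{\tfrac12\|y-x\|^2 + \varphi(x)\}$ is the set of global minimizers (a minimizer is required to have finite objective value, so the set is empty if $\varphi\equiv+\infty$). A function $f:\mathcal{Y}\to\mathcal{H}$ is a proximity operator of $\varphi$ if $f(y) \in \mathrm{prox}_\varphi(y)$ for each $y\in\mathcal{Y}$. Differentiability is in the Fréchet sense; $Df(y)$ is the differential of $f$ at $y$. Convex functions are functions $\psi:\mathcal{H}\to\mathbb{R}\cup\{+\infty\}$; ''$C^2$ on $\mathcal{Y}$'' means finite and twice continuously Fréchet differentiable on the open set $\mathcal{Y}$. A continuous linear operator $L:\mathcal{H}\to\mathcal{H}$ is symmetric if $\langle x,Ly\rangle=\langle Lx,y\rangle$ for all $x,y\in\mathcal{H}$; a symmetric $L$ is positive semi-definite if $\langle x,Lx\rangle\geq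 0$ for all $x\in\mathcal{H}$. *)

(* Defs.v *)
From HB Require Import structures.
From mathcomp Require Import all_boot all_order all_algebra.
From mathcomp Require Import sesquilinear.
From mathcomp Require Import all_classical all_reals all_analysis.

Set Implicit Arguments.
Unset Strict Implicit.
Unset Printing Implicit Defensive.

Import Order.TTheory GRing.Theory Num.Theory.
Import numFieldNormedType.Exports.

Local Open Scope classical_set_scope.
Local Open Scope ring_scope.

(* A real Hilbert space is a complete normed module [H] over [R : realType]
   with a positive definite symmetric bilinear form [dot : {dot H for idfun}]
   that induces the norm.

   Functions on an open set [Y] are represented by functions on the whole
   space; the notions below only depend on their restriction to [Y], because
   differentiability and ['d f y] only depend on [f] near [y].  Likewise a
   function into R U {+oo} is a function into [\bar R] avoiding [-oo]. *)

Section Smoothness.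
Context {R : realType} {V W : normedModType R}.
Implicit Types (Y : set V) (f : V -> W).

(* The estimate says that the operator norm of [Df(z) - Df(y)] is at most
   [e]: the differential is continuous for the operator norm. *)
Definition C1_on Y f : Prop :=
  (forall y, Y y -> differentiable f y) /\
  (forall y, Y y -> forall e : R, 0 < e ->
     \forall z \near y, forall h, `|'d f z h - 'd f y h| <= e * `|h|).

(* [B] is the Frechet differential at [y] of the map [z |-> Df(z)], which
   takes its values in the space L(V, W) of continuous linear maps with the
   operator norm.  As usual L(V, L(V, W)) is identified with the bounded
   bilinear maps, [B h k] standing for [(D(Df)(y) h) k]. *)
Definition is_second_diff f (y : V) (B : {bilinear V -> V -> W}) : Prop :=
  (exists M : R, forall h k, `|B h k| <= M * `|h| * `|k|) /\
  (forall e : R, 0 < e ->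
     \forall h \near (0 : V), forall k,
       `|'d f (y + h) k - 'd f y k - B h k| <= e * `|h| * `|k|).

Definition C2_on Y f : Prop :=
  (forall y, Y y -> differentiable f y) /\
  exists D2f : V -> {bilinear V -> V -> W},
    (forall y, Y y -> is_second_diff f y (D2f y)) /\
    (forall y, Y y -> forall e : R, 0 < e ->
       \forall z \near y, forall h k,
         `|D2f z h k - D2f y h k| <= e * `|h| * `|k|).

End Smoothness.

Section Proximity.
Context {R : realType} {H : completeNormedModType R}.

Definition prox_objective (phi : H -> \bar R) (y x : H) : \bar R :=
  ((2^-1 * `|y - x| ^+ 2)%:E + phi x)%E.

Definition prox (phi : H -> \bar R) (y : H) : set H :=
  [set x | prox_objective phi y x \is a fin_num /\
           forall x', (prox_objective phi y x <= prox_objective phi y x')%E].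

Definition is_proximity_operator (Y : set H) (f : H -> H)
    (phi : H -> \bar R) : Prop :=
  forall y, Y y -> prox phi y (f y).

(* The convention [0 * +oo = 0] of [\bar R] makes the cases [t = 0] and
   [t = 1] trivially true. *)
Definition convex_efun (psi : H -> \bar R) : Prop :=
  forall (x y : H) (t : R), 0 <= t <= 1 ->
    (psi (t *: x + (1 - t) *: y)%R <= t%:E * psi x + (1 - t)%:E * psi y)%E.

(* [fine] is the real value of a finite extended real. *)
Definition C2_efun_on (Y : set H) (psi : H -> \bar R) : Prop :=
  (forall y, Y y -> psi y \is a fin_num) /\
  C2_on Y (fun x => fine (psi x) : R^o).

Variable dot : {dot H for idfun}.

Definition is_gradient (g : H -> R^o) (y v : H) : Prop :=
  differentiable g y /\ forall h, 'd g y h = dot v h.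

Definition symmetric_op (L : {linear H -> H}) : Prop :=
  forall x y, dot x (L y) = dot (L x) y.

Definition psd_op (L : {linear H -> H}) : Prop :=
  forall x, 0 <= dot x (L x).

End Proximity.

(* Main.v *)
Require Import Defs.
From HB Require Import structures.
From mathcomp Require Import all_boot all_order all_algebra.
From mathcomp Require Import sesquilinear.
From mathcomp Require Import all_classical all_reals all_analysis.
From mathcomp Require Import ring lra.

Set Implicit Arguments.
Unset Strict Implicit.
Unset Printing Implicit Defensive.

Import Order.TTheory GRing.Theory Num.Theory.
Import numFieldNormedType.Exports.

Local Open Scope classical_set_scope.
Local Open Scope ring_scope.

(* Each of (a), (b), (c) is equivalent to the existence of a function g on Y
   such that f y is a subgradient of g at y (relative to Y) for every y in Y.
   For (a), g and phi + |.|^2/2 are conjugate.  For (b), extend g by the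
   supremum of its affine minorants; as f is continuous it is the gradient.

   From (c) to g, without integration: approximate the line integral of f along
   a segment by the trapezoidal sums over its dyadic subdivisions.  Repeated
   bisection and the positivity of Df show that f is monotone.  Goursat's
   argument (quartering a triangle, with a linear approximation of f at the
   limit point, where the circulation vanishes because Df is symmetric) shows
   that the sums around any triangle tend to 0.  Hence the limits of the sums
   from a base point to y define g y, and monotonicity gives the subgradient
   inequality.  Conversely, when g exists the sums along [a, b] tend to
   g b - g a, so they tend to 0 around a triangle; comparing with the
   circulation of the linear part of f around small triangles gives the
   symmetry of Df. *)

(** * Dyadic subdivision sums along segments and around triangles *)

Section Dyadic.
Context {R : realType} {H : lmodType R}.
Implicit Types (a b x y : H) (k n : nat) (s : H -> H -> R) (f : H -> H).

Definition mid a b : H := 2^-1 *: (a + b).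

Lemma midC a b : mid a b = mid b a.
Proof. by rewrite /mid addrC. Qed.

Lemma midxx a : mid a a = a.
Proof.
by rewrite /mid -mulr2n -(scaler_nat 2 a) scalerA mulVf ?scale1r ?pnatr_eq0.
Qed.

Lemma mid_sub_mid a b c : mid a c - mid a b = 2^-1 *: (c - b).
Proof. by rewrite /mid -scalerBr opprD addrACA subrr add0r. Qed.

Lemma mid_subl a b : mid a b - a = 2^-1 *: (b - a).
Proof. by rewrite -{2}(midxx a) mid_sub_mid. Qed.

Lemma mid_subr a b : b - mid a b = 2^-1 *: (b - a).
Proof. by rewrite -opprB midC mid_subl -scalerN opprB. Qed.

Definition midpoint_closed (C : set H) := forall a b, C a -> C b -> C (mid a b).

(** A Riemann-type sum over 2^k equal pieces of [a, b]; recursive halving allows inductions based on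
    closure under midpoints. *)
Fixpoint dyadic s k a b : R :=
  if k is k'.+1 then dyadic s k' a (mid a b) + dyadic s k' (mid a b) b
  else s a b.

Lemma dyadic_le (C : set H) s s' k a b : midpoint_closed C ->
  (forall x y, C x -> C y -> s x y <= s' x y) -> C a -> C b ->
  dyadic s k a b <= dyadic s' k a b.
Proof.
move=> Cmid ss'; elim: k a b => [|k IH] a b Ca Cb /=; first exact: ss'.
by rewrite lerD // IH //; exact: Cmid.
Qed.

Lemma dyadic_ge_id (C : set H) s k a b : midpoint_closed C ->
  (forall x y, C x -> C y -> s x y <= s x (mid x y) + s (mid x y) y) ->
  C a -> C b -> s a b <= dyadic s k a b.
Proof.
move=> Cmid sup; elim: k a b => [//|k IH] a b Ca Cb /=.
apply: (le_trans (sup _ _ Ca Cb)).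
by rewrite lerD // IH //; exact: Cmid.
Qed.

Lemma dyadic_nondecreasing (C : set H) s k a b : midpoint_closed C ->
  (forall x y, C x -> C y -> s x y <= s x (mid x y) + s (mid x y) y) ->
  C a -> C b -> dyadic s k a b <= dyadic s k.+1 a b.
Proof.
move=> Cmid sup; elim: k a b => [|k IH] a b Ca Cb; first exact: sup.
by apply: lerD; apply: IH => //; exact: Cmid.
Qed.

Lemma dyadicN s k a b :
  dyadic (fun x y => - s y x) k a b = - dyadic s k b a.
Proof.
elim: k a b => [//|k IH] a b /=.
by rewrite !IH (midC b a) opprD addrC.
Qed.

Lemma dyadic_antisym s k a b : (forall x y, s x y = - s y x) ->
  dyadic s k a b = - dyadic s k b a.
Proof.
move=> anti; elim: k a b => [|k IH] a b /=; first exact: anti.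
by rewrite IH addrC IH (midC b a) -opprD.
Qed.

Lemma dyadic_coboundary (g : H -> R) k a b :
  dyadic (fun x y => g y - g x) k a b = g b - g a.
Proof. by elim: k a b => [//|k IH] a b /=; rewrite !IH; ring. Qed.

Definition tri s a b c : R := s a b + s b c + s c a.

(* Cut a triangle into four along the midpoints of its sides: by antisymmetry
   the inner sides cancel. *)
Lemma tri_dyadicS s k a b c : (forall x y, s x y = - s y x) ->
  tri (dyadic s k.+1) a b c =
  tri (dyadic s k) a (mid a b) (mid a c) + tri (dyadic s k) (mid a b) b (mid b c)
  + tri (dyadic s k) (mid a c) (mid b c) c
  + tri (dyadic s k) (mid a b) (mid b c) (mid a c).
Proof.
move=> anti; rewrite /tri /= (midC c a).
rewrite (dyadic_antisym k (mid b c) (mid a b) anti).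
rewrite (dyadic_antisym k (mid a c) (mid b c) anti).
rewrite (dyadic_antisym k (mid a b) (mid a c) anti).
ring.
Qed.

End Dyadic.

(** * Bilinearity rules and the Cauchy-Schwarz inequality *)

Section InnerProduct.
Context {R : realType} {H : normedModType R} (dot : {dot H for idfun}).
Hypothesis dot_norm : forall x : H, dot x x = `|x| ^+ 2.
Implicit Types (a b c x y z : H) (t : R).

Lemma dotC x y : dot x y = dot y x.
Proof. by have := @hermitian_subproof _ _ _ _ dot x y; rewrite expr0 mul1r. Qed.

Lemma dotDl x y z : dot (x + y) z = dot x z + dot y z.
Proof. exact: linearDl. Qed.
Lemma dotDr x y z : dot z (x + y) = dot z x + dot z y.
Proof. exact: linearDr. Qed.
Lemma dotNl x z : dot (- x) z = - dot x z.
Proof. exact: linearNl. Qed.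
Lemma dotNr x z : dot z (- x) = - dot z x.
Proof. exact: linearNr. Qed.
Lemma dotBl x y z : dot (x - y) z = dot x z - dot y z.
Proof. exact: linearBl. Qed.
Lemma dotZl t x z : dot (t *: x) z = t * dot x z.
Proof. exact: linearZl_LR. Qed.
Lemma dotZr t x z : dot z (t *: x) = t * dot z x.
Proof. exact: linearZr_LR. Qed.

Definition dotE := (dotDl, dotDr, dotNl, dotNr, dotZl, dotZr).

(** The squared norm of |y|^2 x - <x, y> y equals |y|^2 (|x|^2 |y|^2 - <x, y>^2). *)
Lemma dot_le_norm x y : `|dot x y| <= `|x| * `|y|.
Proof.
rewrite -ler_sqr ?nnegrE ?mulr_ge0 ?normr_ge0 // real_normK ?num_real //.
have [->|y0] := eqVneq y 0.
  by rewrite linear0r normr0 mulr0 expr0n.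
have ny : 0 < `|y| ^+ 2 by rewrite exprn_gt0 // normr_gt0.
have := sqr_ge0 `|(`|y| ^+ 2) *: x - dot x y *: y|.
rewrite -[X in 0 <= X]dot_norm !dotE !dot_norm (dotC y x).
rewrite -subr_ge0 -(pmulr_rge0 _ ny).
by set u := `|x|; set v := `|y|; set w := dot x y => h; apply: le_trans h _; lra.
Qed.

End InnerProduct.

(** * Lower and trapezoidal sums for the line integral of [f] *)

Section DyadicSums.
Context {R : realType} {H : normedModType R} (dot : {dot H for idfun}).
Hypothesis dot_norm : forall x : H, dot x x = `|x| ^+ 2.
Implicit Types (a b c x y z : H) (t e : R) (f g : H -> H) (A : {linear H -> H}).

(** The left-endpoint rule; its dyadic sums increase under bisection when [f] is monotone. *)
Definition low f x y : R := dot (f x) (y - x).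
Definition trap f x y : R := 2^-1 * dot (f x + f y) (y - x).

Definition monotone_on (C : set H) f :=
  forall x y, C x -> C y -> 0 <= dot (f y - f x) (y - x).

Lemma trap_antisym f x y : trap f x y = - trap f y x.
Proof. by rewrite /trap -(opprB x y) dotNr mulrN (addrC (f x)). Qed.

Lemma trap_sub_low f x y : trap f x y - low f x y = 2^-1 * dot (f y - f x) (y - x).
Proof. rewrite /trap /low !dotE; lra. Qed.

Lemma low_le_trap (C : set H) f x y : monotone_on C f -> C x -> C y ->
  low f x y <= trap f x y.
Proof. by move=> mf Cx Cy; rewrite -subr_ge0 trap_sub_low mulr_ge0 ?mf. Qed.

(** The gain from bisection is <f m - f x, m - x> with m the midpoint, nonnegative by
    monotonicity. *)
Lemma low_mid (C : set H) f x y : midpoint_closed C -> monotone_on C f ->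
  C x -> C y -> low f x y <= low f x (mid x y) + low f (mid x y) y.
Proof.
move=> Cmid mf Cx Cy; have := mf _ _ Cx (Cmid _ _ Cx Cy).
by rewrite /low mid_subr mid_subl !dotE; lra.
Qed.

(** On each piece the gap is half the product of the increment of [f] with 2^-k (b - a), and these
    increments telescope. *)
Lemma dyadic_trap_sub_low f k a b :
  dyadic (trap f) k a b - dyadic (low f) k a b =
  2^-1 * 2 ^- k * dot (f b - f a) (b - a).
Proof.
elim: k a b => [|k IH] a b.
  by rewrite expr0 invr1 mulr1 trap_sub_low.
rewrite /= opprD addrACA !IH mid_subl mid_subr exprS invfM !dotE.
set u := 2 ^- k; lra.
Qed.

(** Bisection leaves the trapezoidal value of an affine map unchanged, so the errors add up, each at
    most [e] times the length of its piece. *)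
Lemma dyadic_trap_near_affine (C : set H) f A c e k a b : midpoint_closed C ->
  (forall x, C x -> `|f x - (c + A x)| <= e) -> C a -> C b ->
  `|dyadic (trap f) k a b - trap (fun x => c + A x) a b| <= e * `|b - a|.
Proof.
move=> Cmid fA; elim: k a b => [|k IH] a b Ca Cb /=.
  rewrite /trap -mulrBr -dotBl opprD addrACA normrM ger0_norm //.
  rewrite mulrC ler_pdivrMr // (le_trans (dot_le_norm dot_norm _ _)) //.
  rewrite mulrAC ler_wpM2r // (le_trans (ler_normD _ _)) // mulr_natr mulr2n.
  by rewrite lerD // fA.
have split : trap (fun x => c + A x) a b =
    trap (fun x => c + A x) a (mid a b) + trap (fun x => c + A x) (mid a b) b.
  rewrite /trap mid_subl mid_subr (_ : A (mid a b) = 2^-1 *: (A a + A b));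
    last by rewrite linearZ linearD.
  by rewrite !dotE; lra.
rewrite split opprD addrACA (le_trans (ler_normD _ _)) //.
apply: (le_trans (lerD (IH _ _ Ca (Cmid _ _ Ca Cb)) (IH _ _ (Cmid _ _ Ca Cb) Cb))).
rewrite mid_subl mid_subr !normrZ ger0_norm // -mulrDr -mulrDl.
by rewrite [X in X * `|_|](_ : _ = 1) ?mul1r //; lra.
Qed.

(** Around a triangle the constant [c] cancels and the skew part of [A] remains, so the value
    vanishes when [A] is symmetric. *)
Lemma tri_trap_affine A c a b d :
  tri (trap (fun x => c + A x)) a b d =
  2^-1 * (dot (A a) b - dot a (A b) + (dot (A b) d - dot b (A d))
          + (dot (A d) a - dot d (A a))).
Proof.
rewrite /tri /trap !dotE (dotC dot b) (dotC dot d (A a)) (dotC dot a (A b)); lra.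
Qed.

End DyadicSums.

(** * Geometric sequences and limits of nested bisections *)

Lemma exists_dyadic_lt (R : realType) (D e : R) : 0 < e -> exists n, D * 2 ^- n < e.
Proof.
move=> e0; have : (fun n => D * 2^-1 ^+ n : R) @ \oo --> (D * 0 : R).
  by apply: cvgMr; apply: cvg_expr; rewrite ger0_norm // invf_lt1 // ltr1n.
rewrite mulr0 => /cvgrPdist_lt /(_ _ e0) [n _ /(_ n (leqnn n))].
rewrite sub0r normrN exprVn => ?.
by exists n; apply: le_lt_trans (ler_norm _) _.
Qed.

Lemma geometric_cauchy_limit (R : realType) (H : completeNormedModType R)
    (x : nat -> H) (D : R) :
  (forall n, `|x n.+1 - x n| <= D * 2 ^- n) ->
  exists p, forall n, `|x n - p| <= 2 * D * 2 ^- n.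
Proof.
move=> xS.
have D0 : 0 <= D.
  by have := le_trans (normr_ge0 _) (xS 0%N); rewrite expr0 invr1 mulr1.
have tail n k : `|x (n + k)%N - x n| <= 2 * D * 2 ^- n - 2 * D * 2 ^- (n + k).
  elim: k => [|k IH]; first by rewrite addn0 !subrr normr0.
  rewrite addnS -(subrKA (x (n + k)%N)).
  apply: (le_trans (ler_normD _ _)); apply: (le_trans (lerD (xS _) IH)).
  by rewrite exprS invfM; set u := _ ^- (n + k); lra.
have tail_le n m : (n <= m)%N -> `|x m - x n| <= 2 * D * 2 ^- n.
  move=> /subnKC <-; apply: (le_trans (tail _ _)).
  by rewrite gerBl !mulr_ge0 // invr_ge0 exprn_ge0.
have /cauchy_cvgP/cvg_ex[p xp] : cauchy (x @ \oo).
  apply: cauchy_exP => e e0; have [n ne] := exists_dyadic_lt (2 * D) e0.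
  exists (x n); exists n => // m /= nm; rewrite -ball_normE /= distrC.
  exact: le_lt_trans (tail_le _ _ nm) ne.
exists p => n; apply/ler_addgt0Pr => e e0.
move/cvgrPdist_lt : xp => /(_ _ e0) [m _ /(_ (maxn n m) (leq_maxr _ _))].
rewrite distrC => xmp; rewrite -(subrKA (x (maxn n m))).
apply: (le_trans (ler_normD _ _)); rewrite lerD ?(ltW xmp) //.
by rewrite distrC tail_le // leq_maxl.
Qed.

(** Dependent choice builds a chain of states whose positions form a geometric Cauchy sequence; the
    invariant [S] may vary with the stage. *)
Lemma nested_limit (R : realType) (H : completeNormedModType R) (T : Type)
    (S : nat -> T -> Prop) (pos : T -> H) (D : R) (t0 : T) :
  S 0%N t0 ->
  (forall n t, S n t -> exists2 t', S n.+1 t' & `|pos t' - pos t| <= D * 2 ^- n) ->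
  exists p, forall n, exists2 t, S n t & `|pos t - p| <= 2 * D * 2 ^- n.
Proof.
move=> S0 step.
pose X := {nt : nat * T | S nt.1 nt.2}.
pose Rel (u v : X) := (sval v).1 = (sval u).1.+1 /\
  `|pos (sval v).2 - pos (sval u).2| <= D * 2 ^- (sval u).1.
have RelP (u : X) : {v : X | Rel u v}.
  case: u => -[n t] /= St; apply: cid; have [t' St' tt'] := step n t St.
  by exists (exist (fun nt => S nt.1 nt.2) (n.+1, t') St').
pose u0 : X := exist (fun nt => S nt.1 nt.2) (0%N, t0) S0.
have [u [u0E uS]] := dependent_choice RelP u0.
have u1 n : (sval (u n)).1 = n.
  by elim: n => [|n IH]; [rewrite u0E | rewrite (uS n).1 IH].
have /geometric_cauchy_limit[p pP] n :
    `|pos (sval (u n.+1)).2 - pos (sval (u n)).2| <= D * 2 ^- n.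
  by have := (uS n).2; rewrite u1.
exists p => n; exists (sval (u n)).2; last exact: pP.
by have := svalP (u n); rewrite u1.
Qed.

(** * First-order approximation near a point *)

Lemma differentiable_near (R : realType) (V W : normedModType R) (f : V -> W)
    (p : V) (e : R) : differentiable f p -> 0 < e ->
  exists2 r : R, 0 < r &
    forall x, `|x - p| < r -> `|f x - f p - 'd f p (x - p)| <= e * `|x - p|.
Proof.
move=> /diff_locally/eqaddoP fp e0.
have /nbhs_norm0P[r /= r0 rP] := fp _ e0.
exists r => // x xpr; have := rP _ xpr.
by rewrite !fctE /= subrK opprD addrA.
Qed.

(** In the ball of radius rho the affine approximation errs by at most (e / 6) rho and a side has
    length at most 2 rho: three sides give e rho^2, at every level [k]. *)
Lemma tri_near_affine (R : realType) (H : normedModType R)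
    (dot : {dot H for idfun}) (dot_norm : forall x : H, dot x x = `|x| ^+ 2)
    (f : H -> H) (p : H) (e : R) : differentiable f p -> 0 < e ->
  exists2 r : R, 0 < r & forall rho, rho < r -> forall a b c k,
    `|a - p| <= rho -> `|b - p| <= rho -> `|c - p| <= rho ->
    `|tri (dyadic (trap dot f) k) a b c -
      tri (trap dot (fun x => f p - 'd f p p + 'd f p x)) a b c| <= e * rho ^+ 2.
Proof.
move=> df e0; have e60 : 0 < e / 6 by rewrite divr_gt0.
have [r r0 rP] := differentiable_near df e60.
exists r => // rho rhor a b c k ap bp cp.
pose C : set H := [set x | `|x - p| <= rho].
have Cmid : midpoint_closed C.
  move=> x y; rewrite /C /= => xp yp.
  rewrite -{1}(midxx p) /mid -scalerBr opprD addrACA.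
  rewrite normrZ ger0_norm // mulrC ler_pdivrMr //.
  by apply: (le_trans (ler_normD _ _)); move: xp yp; lra.
have fC x : C x -> `|f x - (f p - 'd f p p + 'd f p x)| <= e / 6 * rho.
  move=> /= xp; rewrite (_ : f x - _ = f x - f p - 'd f p (x - p)).
    apply: (le_trans (rP _ (le_lt_trans xp rhor))).
    by rewrite ler_wpM2l // ltW.
  by rewrite linearB /= !opprD !opprK -!addrA [- 'd f p x + _]addrC.
have est := dyadic_trap_near_affine dot_norm k Cmid fC.
have dist x y : C x -> C y -> `|y - x| <= 2 * rho.
  rewrite /C /= => xp yp; rewrite -(subrKA p); apply: (le_trans (ler_normD _ _)).
  by rewrite (distrC p x); move: xp yp; lra.
have rho0 : 0 <= rho by apply: le_trans ap.
have side x y : C x -> C y ->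
    `|dyadic (trap dot f) k x y - trap dot (fun x => f p - 'd f p p + 'd f p x) x y|
    <= e / 3 * rho ^+ 2.
  move=> Cx Cy; apply: (le_trans (est _ _ Cx Cy)).
  rewrite (_ : e / 3 * rho ^+ 2 = e / 6 * rho * (2 * rho)); last by field.
  by rewrite ler_wpM2l ?dist // mulr_ge0 // ltW.
rewrite /tri; move: (side _ _ ap bp) (side _ _ bp cp) (side _ _ cp ap).
rewrite !ler_norml; set u := e / 3 * rho ^+ 2.
have -> : e * rho ^+ 2 = 3 * u by rewrite /u; field.
by move=> /andP[? ?] /andP[? ?] /andP[? ?]; apply/andP; split; lra.
Qed.

(** * Relative subgradients, and points with a margin inside a set *)

Definition subgradient_on (R : realType) (H : normedModType R)
    (dot : {dot H for idfun}) (Y : set H) (g : H -> R) (f : H -> H) :=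
  forall y z, Y y -> Y z -> g y + dot (f y) (z - y) <= g z.

(* A limit of points of [shrink Y e] lies in [Y]: this replaces the compactness
   of segments and triangles in the nested bisections. *)
Definition shrink (R : realType) (H : normedModType R) (Y : set H) (e : R) : set H :=
  [set x | forall u, `|u| < e -> Y (x + u)].

Section Shrink.
Context {R : realType} {H : normedModType R}.
Implicit Types (Y : set H) (e : R).

Lemma shrink_midpoint_closed Y e : midpoint_closed Y -> midpoint_closed (shrink Y e).
Proof.
move=> Ymid a b Ka Kb u ue.
rewrite (_ : mid a b + u = mid (a + u) (b + u)); last first.
  by rewrite -{1}(midxx u) /mid -scalerDr addrACA.
by apply: Ymid; [exact: Ka | exact: Kb].
Qed.

Lemma shrink_near Y e x p : shrink Y e x -> `|x - p| < e -> Y p.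
Proof. by move=> Kx; rewrite distrC => /Kx; rewrite subrKC. Qed.

Lemma shrink_le Y e e' x : e <= e' -> shrink Y e' x -> shrink Y e x.
Proof. by move=> ee' Kx u ue; apply: Kx; exact: lt_le_trans ee'. Qed.

Lemma open_shrink Y x : open Y -> Y x -> exists2 e, 0 < e & shrink Y e x.
Proof.
move=> Yo Yx; have /nbhs_normP[e /= e0 eY] := open_nbhs_nbhs (conj Yo Yx).
by exists e => // u ue; apply: eY; rewrite /= opprD addrA subrr sub0r normrN.
Qed.

End Shrink.

(** * From a symmetric positive semi-definite differential to a potential *)

Section Goursat.
Context {R : realType} {H : completeNormedModType R} (dot : {dot H for idfun}).
Hypothesis dot_norm : forall x : H, dot x x = `|x| ^+ 2.
Variables (Y : set H) (f : H -> H).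
Hypotheses (Y_open : open Y) (Y_mid : midpoint_closed Y).
Hypothesis f_diff : forall y, Y y -> differentiable f y.

(** If <f y - f x, y - x> = M < 0, one half of each bad segment keeps a quarter of the defect. At
    length D 2^-n the defect is still M 4^-n, which contradicts the sign of Df at the limit
    point. *)
Lemma psd_monotone_on : (forall y, Y y -> psd_op dot ('d f y)) ->
  monotone_on dot Y f.
Proof.
move=> f_psd x y Yx Yy; rewrite leNgt; apply/negP.
set M := dot _ _ => M0; set D := `|y - x|.
have D0 : 0 < D.
  rewrite normr_gt0; apply: contraTneq M0 => yx.
  by rewrite /M yx linear0r ltxx.
have [e1 e10 Kx] := open_shrink Y_open Yx.
have [e2 e20 Ky] := open_shrink Y_open Yy.
pose e := Num.min e1 e2.
have e0 : 0 < e by rewrite lt_min e10.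
pose S n (t : H * H) := [/\ shrink Y e t.1, shrink Y e t.2,
  `|t.2 - t.1| = D * 2 ^- n &
  dot (f t.2 - f t.1) (t.2 - t.1) <= M * (2 ^- n) ^+ 2].
have S0 : S 0%N (x, y).
  split; rewrite /= ?expr0 ?invr1 ?expr1n ?mulr1 //.
  - by apply: shrink_le Kx; rewrite ge_min lexx.
  - by apply: shrink_le Ky; rewrite ge_min lexx orbT.
have step n t : S n t -> exists2 t', S n.+1 t' & `|t'.1 - t.1| <= D * 2 ^- n.
  case: t => a b [/= Ka Kb ab Mab].
  have Km : shrink Y e (mid a b) by exact: shrink_midpoint_closed.
  have half : `|2^-1 *: (b - a)| = D * 2 ^- n.+1.
    by rewrite normrZ ger0_norm // ab exprS invfM mulrCA.
  have [Mam|Mam] := lerP (dot (f (mid a b) - f a) (mid a b - a))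
                         (M * (2 ^- n.+1) ^+ 2).
    exists (a, mid a b); first by split; rewrite //= mid_subl.
    by rewrite subrr normr0 mulr_ge0 ?invr_ge0 ?exprn_ge0 // ltW.
  exists (mid a b, b); last first.
    rewrite /= mid_subl half exprS invfM ler_wpM2l ?(ltW D0) //.
    by rewrite ler_piMl ?invr_ge0 ?exprn_ge0 // invf_le1 // ler1n.
  split; rewrite //= mid_subr //.
  move: Mam Mab; rewrite mid_subl (exprS _ n) invfM !dotE.
  by set u := 2 ^- n; rewrite exprMn; set v := u ^+ 2; lra.
have [p pP] := nested_limit (pos := fst) S0 step.
have Yp : Y p.
  have [n ne] := exists_dyadic_lt (2 * D) e0.
  have [t [Kt _ _ _] tp] := pP n.
  by apply: shrink_near Kt _; exact: le_lt_trans ne.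
(* With d = 2^-n, the errors 2 eta D d at [a] and 3 eta D d at [b], times the length D d, total |M|
   d^2 / 2, less than the defect |M| d^2. *)
pose eta := - M / (10 * D ^+ 2).
have eta0 : 0 < eta by rewrite divr_gt0 ?oppr_gt0 // mulr_gt0 // exprn_gt0.
have [r r0 rP] := differentiable_near (f_diff Yp) eta0.
have [n nr] := exists_dyadic_lt (3 * D) r0.
have [[a b] [/= _ _ ab Mab] ap] := pP n.
set d := 2 ^- n in nr ab Mab ap.
have d0 : 0 < d by rewrite invr_gt0 exprn_gt0.
have bp : `|b - p| <= 3 * D * d.
  rewrite -(subrKA a); apply: (le_trans (ler_normD _ _)).
  by rewrite ab; move: ap; lra.
have fa := rP a (le_lt_trans ap (lt_trans _ nr)).
have {}fa : `|f a - f p - 'd f p (a - p)| <= eta * (2 * D * d).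
  have Dd0 : 0 < D * d by exact: mulr_gt0.
  by apply: (le_trans (fa _)); [move: Dd0; lra | rewrite ler_wpM2l // ltW].
have {}fb : `|f b - f p - 'd f p (b - p)| <= eta * (3 * D * d).
  by apply: (le_trans (rP _ (le_lt_trans bp nr))); rewrite ler_wpM2l // ltW.
have dba : 'd f p (b - a) = 'd f p (b - p) - 'd f p (a - p).
  by rewrite -linearB /= opprB addrA subrK.
have := f_psd _ Yp (b - a); rewrite (dotC dot) dba => psd.
have ea := le_trans (dot_le_norm dot_norm _ (b - a)) (ler_wpM2r (normr_ge0 _) fa).
have eb := le_trans (dot_le_norm dot_norm _ (b - a)) (ler_wpM2r (normr_ge0 _) fb).
move: ea eb; rewrite ab !ler_norml => /andP[_ ea] /andP[eb _].
have etaD : eta * D ^+ 2 = - M / 10.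
  by rewrite /eta; field; rewrite gt_eqF.
have etaDd k : eta * (k * D * d) * (D * d) = - M / 10 * k * d ^+ 2.
  by rewrite -etaD; ring.
rewrite !etaDd in ea eb.
have : M * d ^+ 2 < 0 by rewrite nmulr_rlt0 // exprn_gt0.
move: psd ea eb Mab; rewrite !dotE; set dd := d ^+ 2.
lra.
Qed.

(** A bad triangle has a quarter that is bad for a quarter of the tolerance, so the tolerance decays
    like the square of the diameter, as does the first-order error. *)
Lemma goursat a b c (e : R) : (forall y, Y y -> symmetric_op dot ('d f y)) ->
  Y a -> Y b -> Y c -> 0 < e ->
  exists K, forall k, (K <= k)%N -> `|tri (dyadic (trap dot f) k) a b c| <= e.
Proof.
move=> f_sym Ya Yb Yc e0; apply: contrapT => nsmall.
pose small (t : H * H * H) (eps : R) := exists K, forall k, (K <= k)%N ->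
  `|tri (dyadic (trap dot f) k) t.1.1 t.1.2 t.2| <= eps.
have [d1 d10 Ka] := open_shrink Y_open Ya.
have [d2 d20 Kb] := open_shrink Y_open Yb.
have [d3 d30 Kc] := open_shrink Y_open Yc.
pose d := Num.min d1 (Num.min d2 d3).
have d0 : 0 < d by rewrite !lt_min d10 d20.
pose D := `|b - a| + `|c - a| + `|c - b| + 1.
have D0 : 0 < D by rewrite ltr_wpDl // !addr_ge0.
pose S n (t : H * H * H) := [/\
  [/\ shrink Y d t.1.1, shrink Y d t.1.2 & shrink Y d t.2],
  [/\ `|t.1.2 - t.1.1| <= D * 2 ^- n, `|t.2 - t.1.1| <= D * 2 ^- n &
      `|t.2 - t.1.2| <= D * 2 ^- n] &
  ~ small t (e * (2 ^- n) ^+ 2)].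
have S0 : S 0%N (a, b, c).
  rewrite /S expr0 invr1 expr1n !mulr1 /=; split => //.
    split; [apply: shrink_le Ka | apply: shrink_le Kb | apply: shrink_le Kc];
    by rewrite !ge_min lexx ?orbT.
  rewrite /D; have := normr_ge0 (b - a); have := normr_ge0 (c - a).
  have := normr_ge0 (c - b); split; lra.
have step n t : S n t -> exists2 t', S n.+1 t' & `|t'.1.1 - t.1.1| <= D * 2 ^- n.
  case: t => [[x y] z] [/= [Kx Ky Kz] [xy xz yz] nsm].
  have Kmid := shrink_midpoint_closed (e := d) Y_mid.
  have [Kxy Kxz Kyz] := And3 (Kmid _ _ Kx Ky) (Kmid _ _ Kx Kz) (Kmid _ _ Ky Kz).
  have half (u : H) : `|u| <= D * 2 ^- n -> `|2^-1 *: u| <= D * 2 ^- n.+1.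
    by move=> un; rewrite normrZ ger0_norm // exprS invfM mulrCA ler_wpM2l.
  have weak : D * 2 ^- n.+1 <= D * 2 ^- n.
    rewrite exprS invfM ler_wpM2l ?(ltW D0) //.
    by rewrite ler_piMl ?invr_ge0 ?exprn_ge0 // invf_le1 // ler1n.
  have D2 : 0 <= D * 2 ^- n by rewrite mulr_ge0 ?invr_ge0 ?exprn_ge0 // ltW.
  apply: contrapT => none.
  have sub t : [/\ shrink Y d t.1.1, shrink Y d t.1.2 & shrink Y d t.2] ->
      [/\ `|t.1.2 - t.1.1| <= D * 2 ^- n.+1, `|t.2 - t.1.1| <= D * 2 ^- n.+1 &
          `|t.2 - t.1.2| <= D * 2 ^- n.+1] -> `|t.1.1 - x| <= D * 2 ^- n ->
      small t (e * (2 ^- n.+1) ^+ 2).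
    by move=> Kt Dt tx; apply: contrapT => nt; apply: none; exists t.
  have [K1 K1P] : small (x, mid x y, mid x z) (e * (2 ^- n.+1) ^+ 2).
    apply: sub => //=; last by rewrite subrr normr0.
    rewrite !mid_subl mid_sub_mid; split; exact: half.
  have [K2 K2P] : small (mid x y, y, mid y z) (e * (2 ^- n.+1) ^+ 2).
    apply: sub => //=; last by rewrite mid_subl (le_trans (half _ xy)).
    rewrite mid_subr mid_subl (midC x y) mid_sub_mid; split; exact: half.
  have [K3 K3P] : small (mid x z, mid y z, z) (e * (2 ^- n.+1) ^+ 2).
    apply: sub => //=; last by rewrite mid_subl (le_trans (half _ xz)).
    by rewrite !mid_subr (midC x z) (midC y z) mid_sub_mid; split; exact: half.
  have [K4 K4P] : small (mid x y, mid y z, mid x z) (e * (2 ^- n.+1) ^+ 2).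
    apply: sub => //=; last by rewrite mid_subl (le_trans (half _ xy)).
    split; [rewrite (midC x y) mid_sub_mid | rewrite mid_sub_mid |
      rewrite (midC x z) (midC y z) mid_sub_mid -(opprB y x) scalerN normrN];
    exact: half.
  (* One level of subdivision is spent on the quartering, hence the successor. *)
  apply: nsm; exists (maxn (maxn K1 K2) (maxn K3 K4)).+1 => -[//|k].
  rewrite ltnS !geq_max => /andP[/andP[k1 k2] /andP[k3 k4]].
  rewrite tri_dyadicS; last exact: trap_antisym.
  move: (K1P _ k1) (K2P _ k2) (K3P _ k3) (K4P _ k4) => /=.
  rewrite (exprS _ n) invfM exprMn; set v := (2 ^- n) ^+ 2; rewrite !ler_norml.
  move=> /andP[? ?] /andP[? ?] /andP[? ?] /andP[? ?]; apply/andP; split; lra.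
have [p pP] := nested_limit (pos := fun t => t.1.1) S0 step.
have Yp : Y p.
  have [n ne] := exists_dyadic_lt (2 * D) d0.
  have [t [[Kt _ _] _ _] tp] := pP n.
  by apply: shrink_near Kt _; exact: le_lt_trans ne.
(* Vertices lie within rho = 3 D 2^-n of [p], and this constant times rho^2 is the tolerance e
   4^-n. *)
have e1 : 0 < e / (9 * D ^+ 2) by rewrite divr_gt0 // mulr_gt0 // exprn_gt0.
have [r r0 rP] := tri_near_affine dot_norm (f_diff Yp) e1.
have [n nr] := exists_dyadic_lt (3 * D) r0.
have [[[x y] z] [/= _ [xy xz _] nsm] xp] := pP n.
apply: nsm; exists 0%N => k _ /=.
have Dn : 0 <= D * 2 ^- n by rewrite mulr_ge0 ?invr_ge0 ?exprn_ge0 // ltW.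
have near w : `|w - x| <= D * 2 ^- n -> `|w - p| <= 3 * D * 2 ^- n.
  move=> wx; rewrite -(subrKA x); apply: (le_trans (ler_normD _ _)).
  by move: xp wx; lra.
have := rP _ nr x y z k _ (near _ xy) (near _ xz).
rewrite tri_trap_affine !(f_sym _ Yp) !subrr !addr0 mulr0 subr0.
move/(_ _)/le_trans; apply; first by apply: near; rewrite subrr normr0.
rewrite !exprMn le_eqVlt; apply/orP; left; apply/eqP; field.
by rewrite expf_neq0 ?gt_eqF ?pnatr_eq0.
Qed.

Lemma potential_exists : Y !=set0 ->
  (forall y, Y y -> symmetric_op dot ('d f y) /\ psd_op dot ('d f y)) ->
  exists g, subgradient_on dot Y g f.
Proof.
move=> [y0 Yy0] f_sp.
have mf : monotone_on dot Y f by apply: psd_monotone_on => y /f_sp[].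
have f_sym y : Y y -> symmetric_op dot ('d f y) by move=> /f_sp[].
pose L k y := dyadic (low dot f) k y0 y.
pose g y := sup (range (L^~ y)).
have Lmono y : Y y -> {homo L^~ y : n m / (n <= m)%N >-> n <= m}.
  move=> Yy; apply/nondecreasing_seqP => k.
  by apply: dyadic_nondecreasing Yy0 Yy => // u v; exact: low_mid.
have L_sup y : Y y -> has_sup (range (L^~ y)).
  move=> Yy; split; first by exists (L 0%N y); exists 0%N.
  (* By monotonicity each lower term is at most the right-endpoint term, and the right-endpoint sum
     is minus a lower sum from [y] to [y0]. *)
  exists (- low dot f y y0) => _ [k _ <-].
  apply: (@le_trans _ _ (dyadic (fun u v => - low dot f v u) k y0 y)).
    apply: dyadic_le Yy0 Yy => // u v Yu Yv.
    by have := mf u v Yu Yv; rewrite /low !dotE; lra.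
  rewrite dyadicN lerN2.
  by apply: dyadic_ge_id Yy Yy0 => // u v; exact: low_mid.
exists g => y z Yy Yz.
apply/ler_addgt0Pr => e e0.
rewrite -lerBrDr; apply: ge_sup; first by exists (L 0%N y); exists 0%N.
move=> _ [k0 _ <-].
have e2 : 0 < e / 2 by rewrite divr_gt0.
have [K KP] := goursat f_sym Yy0 Yy Yz e2.
have [N NP] := exists_dyadic_lt (dot (f z - f y0) (z - y0)) e0.
(* Half of [e] pays for the circulation around the triangle, half for the gap between trapezoidal
   and lower sums at [z]. *)
pose k := maxn k0 (maxn K N).
have k0k : (k0 <= k)%N by rewrite leq_maxl.
have Kk : (K <= k)%N by rewrite /k maxnCA leq_maxl.
have Nk : (N <= k)%N by rewrite /k maxnA leq_maxr.
have L0 := Lmono y Yy _ _ k0k.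
have Lg : L k z <= g z by apply: ub_le_sup; [exact: (L_sup z Yz).2 | exists k].
(* The trapezoidal and lower sums have the same limit. *)
have gapy := dyadic_trap_sub_low dot f k y0 y.
have gapz := dyadic_trap_sub_low dot f k y0 z.
have gap0 : 0 <= 2^-1 * 2 ^- k * dot (f y - f y0) (y - y0).
  by rewrite !mulr_ge0 ?invr_ge0 ?exprn_ge0 // mf.
have gape : 2^-1 * 2 ^- k * dot (f z - f y0) (z - y0) < e / 2.
  have : 2 ^- k * dot (f z - f y0) (z - y0) < e.
    apply: le_lt_trans NP; rewrite mulrC ler_wpM2l ?mf //.
    by rewrite lef_pV2 ?posrE ?exprn_gt0 // ler_weXn2l // ler1n.
  lra.
have low_yz : low dot f y z <= dyadic (trap dot f) k y z.
  apply: (@le_trans _ _ (dyadic (low dot f) k y z)).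
    by apply: dyadic_ge_id Yy Yz => // u v; exact: low_mid.
  by apply: dyadic_le Yy Yz => // u v; exact: low_le_trap.
have := KP _ Kk; rewrite /tri (dyadic_antisym _ z y0 (trap_antisym _ _)).
rewrite ler_norml => /andP[_ J].
move: L0 Lg gapy gapz gap0 gape low_yz J; rewrite /L /low; lra.
Qed.
End Goursat.

(** * Consequences of a potential for the differential *)

Section Subgradient.
Context {R : realType} {H : completeNormedModType R} (dot : {dot H for idfun}).
Hypothesis dot_norm : forall x : H, dot x x = `|x| ^+ 2.
Implicit Types (Y : set H) (f : H -> H) (g : H -> R).

Lemma subgradient_monotone Y g f :
  subgradient_on dot Y g f -> monotone_on dot Y f.
Proof.
move=> sg y z Yy Yz; have := sg _ _ Yy Yz; have := sg _ _ Yz Yy.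
by rewrite !dotE; lra.
Qed.

(** Monotonicity between y and y + t x, linearised at y with error at most e t^2, gives t^2 (<x,
    Df(y) x> + e) >= 0 for a small t. *)
Lemma monotone_on_psd Y f y : open Y -> Y y -> differentiable f y ->
  monotone_on dot Y f -> psd_op dot ('d f y).
Proof.
move=> Yo Yy df mf x.
have [->|x0] := eqVneq x 0; first by rewrite linear0l.
have nx : 0 < `|x| by rewrite normr_gt0.
apply/ler_addgt0Pr => e e0.
have e1 : 0 < e / `|x| ^+ 2 by rewrite divr_gt0 // exprn_gt0.
have [r r0 rP] := differentiable_near df e1.
have [d d0 dP] := open_shrink Yo Yy.
pose t := Num.min r d / (2 * `|x|).
have m0 : 0 < Num.min r d by rewrite lt_min r0.
have t0 : 0 < t by rewrite divr_gt0 // mulr_gt0.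
have ntx : `|t *: x| = Num.min r d / 2.
  by rewrite normrZ gtr0_norm // /t; field; rewrite gt_eqF.
have [txr txd] : `|t *: x| < r /\ `|t *: x| < d.
  have : Num.min r d <= r by rewrite ge_min lexx.
  have : Num.min r d <= d by rewrite ge_min lexx orbT.
  by rewrite ntx; split; lra.
have := rP (y + t *: x); rewrite addrAC subrr add0r => /(_ txr) est.
have := mf _ _ Yy (dP _ txd); rewrite addrAC subrr add0r => mon.
have := le_trans (dot_le_norm dot_norm _ (t *: x)) (ler_wpM2r (normr_ge0 _) est).
have -> : e / `|x| ^+ 2 * `|t *: x| * `|t *: x| = e * t ^+ 2.
  by rewrite normrZ gtr0_norm //; field; rewrite gt_eqF.
rewrite ler_norml => /andP[_]; move: mon.
have AZ : 'd f y (t *: x) = t *: 'd f y x by rewrite linearZ.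
rewrite AZ (dotC dot x) !dotE => mon est2.
rewrite -(pmulr_rge0 _ (exprn_gt0 2 t0)).
by move: mon est2; lra.
Qed.

(** Lower sums are bounded by increments of [g]; in both directions along the segment, this squeezes
    g b - g a within the gap between trapezoidal and lower sums. *)
Lemma dyadic_trap_subgradient Y g f k a b : midpoint_closed Y ->
  subgradient_on dot Y g f -> Y a -> Y b ->
  `|dyadic (trap dot f) k a b - (g b - g a)| <=
  2^-1 * dot (f b - f a) (b - a) * 2 ^- k.
Proof.
move=> Ymid sg Ya Yb.
have low_le x y : Y x -> Y y -> dyadic (low dot f) k x y <= g y - g x.
  move=> Yx Yy; rewrite -(dyadic_coboundary g k); apply: dyadic_le Yx Yy => //.
  by move=> u v Yu Yv; have := sg _ _ Yu Yv; rewrite /low; lra.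
have := low_le _ _ Ya Yb; have := low_le _ _ Yb Ya.
have := dyadic_trap_sub_low dot f k a b; have := dyadic_trap_sub_low dot f k b a.
rewrite (dyadic_antisym _ b a (trap_antisym _ _)).
have -> : dot (f a - f b) (a - b) = dot (f b - f a) (b - a).
  by rewrite -opprB -(opprB b a) dotNl dotNr opprK.
rewrite ler_norml; set w := dot _ _; set u := 2 ^- k => h1 h2 h3 h4.
by apply/andP; split; lra.
Qed.

(** Around the triangle y, y + t x, y + t z the affine part of [f] has circulation t^2 / 2 times the
    defect of symmetry, while the sums for [f] tend to 0. *)
Lemma subgradient_symmetric Y g f y : open Y -> midpoint_closed Y -> Y y ->
  differentiable f y -> subgradient_on dot Y g f -> symmetric_op dot ('d f y).
Proof.
move=> Yo Ymid Yy df sg x z.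
apply/eqP; rewrite -subr_eq0 -normr_le0; apply/ler_addgt0Pr => e e0.
rewrite add0r distrC.
pose M := `|x| + `|z| + 1.
have M0 : 0 < M by rewrite ltr_wpDl // addr_ge0.
have e1 : 0 < e / (4 * M ^+ 2) by rewrite divr_gt0 // mulr_gt0 // exprn_gt0.
have [r r0 rP] := tri_near_affine dot_norm df e1.
have [d d0 dP] := open_shrink Yo Yy.
have m0 : 0 < Num.min r d by rewrite lt_min r0.
pose t := Num.min r d / (2 * M).
have t0 : 0 < t by rewrite divr_gt0 // mulr_gt0.
have tM : t * M = Num.min r d / 2 by rewrite /t; field; rewrite gt_eqF.
have [tMr tMd] : t * M < r /\ t * M < d.
  have : Num.min r d <= r by rewrite ge_min lexx.
  have : Num.min r d <= d by rewrite ge_min lexx orbT.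
  by rewrite tM; split; lra.
have near u : `|u| <= M -> `|y + t *: u - y| <= t * M.
  by move=> uM; rewrite addrAC subrr add0r normrZ gtr0_norm // ler_wpM2l // ltW.
have inY u : `|u| <= M -> Y (y + t *: u).
  by move=> /near; rewrite addrAC subrr add0r => /le_lt_trans/(_ tMd)/dP.
have xM : `|x| <= M by have := normr_ge0 z; rewrite /M; lra.
have zM : `|z| <= M by have := normr_ge0 x; rewrite /M; lra.
(* The first-order error and the level-[k] gap are each at most t^2 e / 4, so the defect of symmetry
   is at most [e]. *)
have [k kP] := exists_dyadic_lt
  (2^-1 * (dot (f (y + t *: x) - f y) (y + t *: x - y)
   + dot (f (y + t *: z) - f (y + t *: x)) (y + t *: z - (y + t *: x))
   + dot (f y - f (y + t *: z)) (y - (y + t *: z))))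
  (mulr_gt0 e1 (exprn_gt0 2 (mulr_gt0 t0 M0))).
have := rP _ tMr y (y + t *: x) (y + t *: z) k _ (near _ xM) (near _ zM).
rewrite subrr normr0 => /(_ (mulr_ge0 (ltW t0) (ltW M0))).
have gap := dyadic_trap_subgradient k Ymid sg.
move: (gap _ _ Yy (inY _ xM)) (gap _ _ (inY _ xM) (inY _ zM)) (gap _ _ (inY _ zM) Yy).
have omega : tri (trap dot (fun u => f y - 'd f y y + 'd f y u))
    y (y + t *: x) (y + t *: z) =
    2^-1 * t ^+ 2 * (dot ('d f y x) z - dot x ('d f y z)).
  have AD u : 'd f y (y + t *: u) = 'd f y y + t *: 'd f y u.
    by rewrite linearD linearZ.
  rewrite tri_trap_affine !AD !dotE !(dotC dot _ ('d f y _)); ring.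
move: kP; rewrite omega /tri.
have -> : e / (4 * M ^+ 2) * (t * M) ^+ 2 = t ^+ 2 * e / 4.
  by field; rewrite gt_eqF.
set S1 := dot (f (y + t *: x) - f y) _.
set S2 := dot (f (y + t *: z) - f (y + t *: x)) _.
set S3 := dot (f y - f (y + t *: z)) _.
set T1 := dyadic _ k y _; set T2 := dyadic _ k _ (y + t *: z).
set T3 := dyadic _ k _ y; set u := 2 ^- k.
set w := dot _ z - _ => ku.
rewrite !ler_norml => /andP[? ?] /andP[? ?] /andP[? ?] /andP[? ?].
have t20 : 0 < t ^+ 2 by rewrite exprn_gt0.
apply/andP; split; rewrite -(ler_pM2l t20); lra.
Qed.

End Subgradient.

(** * The gradient and second differential of a potential *)

Section GradientBilinear.
Context {R : realType} {H : completeNormedModType R} (dot : {dot H for idfun}).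
Hypothesis dot_norm : forall x : H, dot x x = `|x| ^+ 2.
Implicit Types (Y : set H) (f : H -> H) (g : H -> R).

Definition dot_left (v : H) : H -> R^o := dot v.

Lemma dot_left_is_linear v : linear (dot_left v).
Proof. by move=> t x y; rewrite /dot_left !dotE. Qed.

HB.instance Definition _ v :=
  GRing.isLinear.Build R H R^o _ (dot_left v) (dot_left_is_linear v).

Lemma dot_left_continuous v : continuous (dot_left v).
Proof.
apply/linear_bounded_continuous.
exists `|v|; split; first exact: num_real.
move=> M vM; near=> x.
apply: (le_trans (dot_le_norm dot_norm v x)).
have x1 : `|x| <= 1.
  by near: x; exact: nbhs0_le.
rewrite (le_trans (ler_wpM2l _ x1)) // mulr1; exact: ltW.
Unshelve. all: by end_near. Qed.

(** The increment g(y + h) - g(y) lies between <f(y), h> and <f(y + h), h>, and continuity of [f] at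
    [y] makes their difference o(h). *)
Lemma subgradient_diff Y g f y : open Y -> Y y -> differentiable f y ->
  subgradient_on dot Y g f ->
  differentiable (g : H -> R^o) y /\ forall h, 'd (g : H -> R^o) y h = dot (f y) h.
Proof.
move=> Yo Yy df sg.
have expand : (g : H -> R^o) \o shift y =
    cst (g y : R^o) + dot_left (f y) +o_ (0 : H) id.
  apply/eqaddoP => e e0.
  have /cvgrPdist_le/(_ _ e0)/nbhs_normP[r /= r0 rP] : f x @[x --> y] --> f y.
    exact: differentiable_continuous.
  have [d d0 dP] := open_shrink Yo Yy.
  apply/nbhs_norm0P; exists (Num.min r d); first by rewrite /= lt_min r0.
  move=> h /=; rewrite lt_min => /andP[hr hd].
  have Yh := dP _ hd.
  rewrite !fctE /= (addrC h).
  have := sg _ _ Yy Yh; have := sg _ _ Yh Yy.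
  rewrite opprD addrA subrr add0r addrAC subrr add0r dotNr => up lo.
  have fh : `|f y - f (y + h)| <= e.
    by apply: rP; rewrite /= opprD addrA subrr add0r normrN.
  have := le_trans (dot_le_norm dot_norm _ h) (ler_wpM2r (normr_ge0 h) fh).
  rewrite !ler_norml dotBl /dot_left => /andP[? ?].
  by apply/andP; split; lra.
have dg : 'd (g : H -> R^o) y = dot_left (f y) :> (H -> R^o).
  exact: diff_unique (@dot_left_continuous (f y)) expand.
split; last by move=> h; rewrite dg.
by apply/diff_locallyP; split; rewrite dg //; exact: dot_left_continuous.
Qed.

(** The second differential of a function whose gradient is [f]. *)
Definition dot_diff f (y : H) : H -> H -> R^o := fun h k => dot ('d f y h) k.

Lemma dot_diff_is_bilinear f y :
  bilinear_for ( *:%R : GRing.Scale.law R R^o) ( *:%R : GRing.Scale.law R R^o)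
    (dot_diff f y).
Proof.
split=> u t x z /=; rewrite /dot_diff; last by rewrite !dotE.
by rewrite linearD linearZ !dotE.
Qed.

HB.instance Definition _ f y := bilinear_isBilinear.Build R H H R^o _ _
  (dot_diff f y) (dot_diff_is_bilinear f y).

Lemma gradient_C2_on Y (g : H -> R^o) f : open Y -> C1_on Y f ->
  (forall y, Y y -> is_gradient dot g y (f y)) -> C2_on Y g.
Proof.
move=> Yo [df cf] grad; split; first by move=> y /grad[].
exists (fun y => dot_diff f y : {bilinear H -> H -> R^o}); split=> y Yy.
  split.
    have /linear_boundedP[M [_ /(_ (M + 1))]] :
        bounded_near ('d f y) (nbhs (0 : H)).
      by apply/linear_bounded_continuous; exact: diff_continuous (df _ Yy).
    rewrite ltrDl ltr01 => /(_ isT) MP.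
    exists (M + 1) => h k; rewrite (le_trans (dot_le_norm dot_norm _ k)) //.
    by rewrite ler_wpM2r.
  move=> e e0.
  have [r r0 rP] := differentiable_near (df _ Yy) e0.
  have [d d0 dP] := open_shrink Yo Yy.
  apply/nbhs_norm0P; exists (Num.min r d); first by rewrite /= lt_min r0.
  move=> h /=; rewrite lt_min => /andP[hr hd] k.
  have := rP (y + h); rewrite addrAC subrr add0r => /(_ hr) est.
  rewrite (grad _ Yy).2 (grad _ (dP _ hd)).2 /= /dot_diff -!dotBl.
  by rewrite (le_trans (dot_le_norm dot_norm _ k)) // ler_wpM2r.
move=> e e0; apply: filterS (cf _ Yy _ e0) => z zP h k.
rewrite /= /dot_diff -dotBl (le_trans (dot_le_norm dot_norm _ k)) //.
by rewrite ler_wpM2r.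
Qed.

End GradientBilinear.

(** * Proximity operators, convex potentials and the final equivalence *)

Lemma convex_set_midpoint_closed (R : realType) (H : lmodType R) (Y : set H) :
  @convex_set R H Y -> midpoint_closed Y.
Proof.
move=> cY a b Ya Yb.
have h0 : 0 <= 2^-1 :> R by rewrite invr_ge0.
have h1 : 2^-1 <= 1 :> R by rewrite invf_le1 // ler1n.
have := cY a b (Itv01 h0 h1); rewrite !inE => /(_ Ya Yb).
rewrite /conv /= /unstable.onem (_ : 1 - 2^-1 = 2^-1 :> R); last by lra.
by rewrite -scalerDr.
Qed.

Section Equivalences.
Context {R : realType} {H : completeNormedModType R} (dot : {dot H for idfun}).
Hypothesis dot_norm : forall x : H, dot x x = `|x| ^+ 2.
Implicit Types (Y : set H) (f : H -> H) (g : H -> R).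

Lemma sqr_norm_sub (x y : H) :
  `|y - x| ^+ 2 = `|y| ^+ 2 - 2 * dot y x + `|x| ^+ 2.
Proof. rewrite -!dot_norm !dotE (dotC dot x y); ring. Qed.

Lemma prox_subgradient Y f (phi : H -> \bar R) :
  (forall x, phi x != -oo%E) -> is_proximity_operator Y f phi ->
  exists g, subgradient_on dot Y g f.
Proof.
move=> phiN prox_f.
(* The conjugate of phi + |.|^2 / 2 at y, attained at f y; comparing [f z] with the competitor [f y]
   at [z] gives the subgradient inequality. *)
exists (fun y => dot y (f y) - 2^-1 * `|f y| ^+ 2 - fine (phi (f y))).
have fin y : Y y -> phi (f y) \is a fin_num.
  by move=> /prox_f[]; rewrite /prox_objective fin_numD => /andP[].
move=> y z Yy Yz; have := (prox_f _ Yz).2 (f y).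
rewrite /prox_objective -(fineK (fin _ Yy)) -(fineK (fin _ Yz)) /= -!EFinD lee_fin.
by rewrite !sqr_norm_sub !dotE (dotC dot (f y) z) (dotC dot (f y) y); lra.
Qed.

Lemma subgradient_prox Y f g : Y !=set0 -> subgradient_on dot Y g f ->
  exists phi : H -> \bar R,
    (forall x, phi x != -oo%E) /\ is_proximity_operator Y f phi.
Proof.
move=> [y0 Yy0] sg.
(* By the subgradient inequality the supremum at [f y] is attained at [y]. *)
pose phi x : \bar R :=
  ereal_sup [set (dot x y - g y - 2^-1 * `|x| ^+ 2)%:E | y in Y].
have phi_ge x y : Y y -> ((dot x y - g y - 2^-1 * `|x| ^+ 2)%:E <= phi x)%E.
  by move=> Yy; apply: ereal_sup_ubound; exists y.
have phi_f y : Y y -> phi (f y) = (dot (f y) y - g y - 2^-1 * `|f y| ^+ 2)%:E.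
  move=> Yy; apply/eqP; rewrite eq_le phi_ge // andbT.
  apply: ge_ereal_sup => _ [z Yz <-]; rewrite lee_fin.
  by have := sg _ _ Yy Yz; rewrite !dotE; lra.
exists phi; split=> [x|y Yy].
  by rewrite -ltNye (lt_le_trans (ltNyr _) (phi_ge x y0 Yy0)).
rewrite /prox /prox_objective /= phi_f //; split=> // x.
(* Bounding [phi x] below by the term of [y] leaves |y|^2 / 2 - g y, independent of [x] and equal to
   the objective at [f y]. *)
apply: (@le_trans _ _ ((2^-1 * `|y - x| ^+ 2)%:E +
                      (dot x y - g y - 2^-1 * `|x| ^+ 2)%:E)%E); last first.
  by rewrite leeD2l // phi_ge.
rewrite -!EFinD lee_fin !sqr_norm_sub (dotC dot x) (dotC dot (f y)); lra.
Qed.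

Lemma subgradient_convex Y f g : open Y -> Y !=set0 -> C1_on Y f ->
  subgradient_on dot Y g f ->
  exists psi : H -> \bar R,
    [/\ forall x, psi x != -oo%E, convex_efun psi, C2_efun_on Y psi &
        forall y, Y y -> is_gradient dot (fun x => fine (psi x)) y (f y)].
Proof.
move=> Yo [y0 Yy0] f_C1 sg.
(* On [Y] this supremum of affine minorants equals [g]; elsewhere it may be +oo, and nonemptiness of
   [Y] excludes -oo. *)
pose psi x : \bar R := ereal_sup [set (g y + dot (f y) (x - y))%:E | y in Y].
have psi_ge x y : Y y -> ((g y + dot (f y) (x - y))%:E <= psi x)%E.
  by move=> Yy; apply: ereal_sup_ubound; exists y.
have psiE x : Y x -> psi x = (g x)%:E.
  move=> Yx; apply/eqP; rewrite eq_le; apply/andP; split.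
    by apply: ge_ereal_sup => _ [z Yz <-]; rewrite lee_fin sg.
  by have := psi_ge x x Yx; rewrite subrr linear0r addr0.
have grad y : Y y -> is_gradient dot (fun x => fine (psi x)) y (f y).
  move=> Yy; apply: (subgradient_diff dot_norm Yo Yy (f_C1.1 _ Yy)).
  by move=> u v Yu Yv; rewrite !psiE //=; exact: sg.
exists psi; split=> //.
- by move=> x; rewrite -ltNye (lt_le_trans (ltNyr _) (psi_ge x y0 Yy0)).
- move=> x z t /andP[t0 t1]; apply: ge_ereal_sup => _ [y Yy <-].
  have -> : g y + dot (f y) (t *: x + (1 - t) *: z - y) =
      t * (g y + dot (f y) (x - y)) + (1 - t) * (g y + dot (f y) (z - y)).
    by rewrite !dotE; ring.
  rewrite EFinD !EFinM.
  by apply: leeD; apply: lee_wpmul2l; rewrite ?lee_fin ?subr_ge0 //; exact: psi_ge.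
- split; first by move=> y Yy; rewrite psiE.
  exact: gradient_C2_on grad.
Qed.

(** Convexity bounds psi(y + t (z - y)) - psi(y) above by t (psi(z) - psi(y)), differentiability
    bounds it below by t <f(y), z - y> - t e; divide by t. *)
Lemma convex_subgradient Y f (psi : H -> \bar R) :
  (forall x, psi x != -oo%E) -> convex_efun psi ->
  (forall y, Y y -> psi y \is a fin_num) ->
  (forall y, Y y -> is_gradient dot (fun x => fine (psi x)) y (f y)) ->
  subgradient_on dot Y (fun x => fine (psi x)) f.
Proof.
move=> psiN cvx fin grad y z Yy Yz.
have [->|yz] := eqVneq z y; first by rewrite subrr linear0r addr0.
have nzy : 0 < `|z - y| by rewrite normr_gt0 subr_eq0.
apply/ler_addgt0Pr => e e0.
have [dg dgE] := grad _ Yy.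
have e1 : 0 < e / `|z - y| by rewrite divr_gt0.
have [r r0 rP] := differentiable_near dg e1.
pose t := Num.min 1 (r / (2 * `|z - y|)).
have t0 : 0 < t by rewrite lt_min ltr01 divr_gt0 // mulr_gt0.
have t1 : t <= 1 by rewrite ge_min lexx.
have tr : `|t *: (z - y)| < r.
  rewrite normrZ gtr0_norm // -ltr_pdivlMr // (@le_lt_trans _ _ (r / (2 * `|z - y|))) //.
    by rewrite ge_min lexx orbT.
  by rewrite ltr_pM2l // ltf_pV2 ?posrE ?mulr_gt0 // ltr_pMl // ltr1n.
have := cvx z y t; rewrite (ltW t0) t1 => /(_ isT).
have -> : t *: z + (1 - t) *: y = y + t *: (z - y).
  by rewrite scalerBl scale1r scalerBr addrCA.
rewrite -{1}(fineK (fin _ Yy)) -{1}(fineK (fin _ Yz)) -!EFinM -EFinD => up.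
(* The convexity bound is finite and [psi] avoids -oo, so the value at the intermediate point is
   finite. *)
have fint : psi (y + t *: (z - y)) \is a fin_num.
  by rewrite fin_numE psiN /= -ltey (le_lt_trans up) // ltry.
move: up; rewrite -(fineK fint) lee_fin => up.
have := rP (y + t *: (z - y)); rewrite addrAC subrr add0r => /(_ tr).
rewrite dgE dotZr normrZ gtr0_norm //.
have -> : e / `|z - y| * (t * `|z - y|) = t * e by field; rewrite gt_eqF.
rewrite ler_norml => /andP[lo _].
rewrite -(ler_pM2l t0); move: up lo; rewrite /=; lra.
Qed.

End Equivalences.

Theorem theorem2 (R : realType) (H : completeNormedModType R)
    (dot : {dot H for idfun}) (dot_norm : forall x : H, dot x x = `|x| ^+ 2)
    (Y : set H) (Y_nonempty : Y !=set0) (Y_open : open Y)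
    (Y_convex : @convex_set R H Y)
    (f : H -> H) (f_C1 : C1_on Y f) :
  let a := exists phi : H -> \bar R,
    (forall x, phi x != -oo%E) /\ is_proximity_operator Y f phi in
  let b := exists psi : H -> \bar R,
    [/\ forall x, psi x != -oo%E,
        convex_efun psi,
        C2_efun_on Y psi &
        forall y, Y y -> is_gradient dot (fun x => fine (psi x)) y (f y)] in
  let c := forall y, Y y ->
    symmetric_op dot ('d f y) /\ psd_op dot ('d f y) in
  (a <-> b) /\ (b <-> c).
Proof.
have Ymid := convex_set_midpoint_closed Y_convex.
have df := f_C1.1.
move=> a b c.
pose s := exists g, subgradient_on dot Y g f.
have as_ : a -> s by move=> [phi [phiN prox_f]]; exact: prox_subgradient prox_f.
have sa : s -> a by move=> [g sg]; exact: subgradient_prox sg.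
have sb : s -> b by move=> [g sg]; exact: subgradient_convex sg.
have bs : b -> s.
  move=> [psi [psiN cvx [fin _] grad]]; exists (fun x => fine (psi x)).
  exact: convex_subgradient.
have sc : s -> c.
  move=> [g sg] y Yy; split.
    exact: (subgradient_symmetric dot_norm Y_open Ymid Yy (df _ Yy) sg).
  apply: (monotone_on_psd dot_norm Y_open Yy (df _ Yy)).
  exact: subgradient_monotone sg.
have cs : c -> s by exact: (potential_exists dot_norm Y_open Ymid df).
by split; [split=> [/as_/sb|/bs/sa] | split=> [/bs/sc|/cs/sb]].
Qed.
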